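(* Suppose $Y_i^\top=W_i^\top H$ for $i\ge1$, where $H$ is a fixed $K\times J$ matrix with non-negative entries and full row rank, and $\{W_i\}_{i\ge1}$ is an $\mathbb{R}_+^K$-valued process satisfying Assumption E (ergodicity and stationarity) and Assumption S (probabilistic separability). Assume, so that the normalization is defined, that $r_i:=Y_i^\top1_J>0$ for all $i$. Let $\Phi$ be the source attribution matrix derived from $\mathbb{P}_W$ and $H$. Let $\widehat H^*=\widehat H^*_n$ be the matrix whose rows are the points of a maximum-volume $K$-point subset of $S_n=\mathrm{conv}\{Y_1^*,\dots,Y_n^*\}$, where $Y_i^*=Y_i/r_i$, and let $\widetilde m_n^\top=[\,\bar Y_n^\top\ \ \bar r_n\,]R(\widehat H^* )$ with $\bar Y_n=\frac1n\sum_{i=1}^nY_i$, $\bar r_n=\frac1n\sum_{i=1}^nr_i$. Define $\widehat\Phi_n=(\widehat\phi_{kj})$ by $$\widehat\phi_{kj}=\frac{\widetilde m_{n,k}\,\widehat H^*_{kj}}{\sum_{\ell=1}^K\widetilde m_{n,\ell}\,\widehat H^*_{\ell j}} .$$ Then $\widehat\Phi_n$ is a consistent estimator of $\Phi$ up to row permutations, that is, $$\min_{P}\ \|P\widehat\Phi_n-\Phi\|\to0\quad\text{in probability as } n\to\infty,$$ where the minimum is over all $K\times K$ permutation matrices $P$ and $\|\cdot\|$ is any matrix norm.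
   Context: $\mathbb{R}_+=[0,\infty)$; $1_m$ is the $m$-vector of ones; $\mathrm{conv}$ denotes the convex hull in $\mathbb{R}^J$. Assumption E (ergodicity and stationarity): $\{W_i\}_{i\ge1}$ is a (strictly) stationary ergodic process on $\mathbb{R}_+^K$ with marginal distribution $\mathbb{P}_W$ having support $\mathbb{S}_W\subseteq\mathbb{R}_+^K$ (a point $a$ belongs to $\mathbb S_W$ if and only if every open ball around $a$ has positive $\mathbb{P}_W$-probability), and with finite mean $\mu=\mathbb{E}(W_i)$. No independence across $i$ is assumed. Assumption S (probabilistic separability): there exist constants $c_k>0$ such that $c_ke_k\in\mathbb{S}_W$ for every $k=1,\dots,K$, where $e_k$ is the $k$th canonical basis vector of $\mathbb{R}^K$. Source attribution matrix: the $K\times J$ matrix $\Phi=(\phi_{kj})$ with $\phi_{kj}=\mu_kH_{kj}/\sum_{\ell=1}^K\mu_\ell H_{\ell j}$. This definition presupposes that each denominator is positive (no column of $H$ is identically zero). Volume of $K$ points $v_1,\dots,v_K\in\mathbb{R}^J$: $\mathrm{vol}_{K-1}(\mathrm{conv}\{v_1,\dots,v_K\})=\sqrt{|\det(AA^\top)|}/(K-1)!$ with $A=(v_2-v_1,\dots,v_K-v_1)^\top$. If the maximizer is not unique, any maximizer may be chosen; the $K$ points may coincide in degenerate cases. The ordering of the points as rows of $\widehat H^*$ is arbitrary. For a $K\times J$ matrix $M$, let $M_{\mathrm{aug}}=[\,M\ \ 1_K\,]\in\mathbb{R}^{K\times(J+1)}$ and $R(M)=M_{\mathrm{aug}}^\top(M_{\mathrm{aug}}M_{\mathrm{aug}}^\top)^+$,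 where $(\cdot)^+$ is the Moore–Penrose inverse. If a denominator in $\widehat\phi_{kj}$ vanishes, $\widehat\phi_{kj}$ is set to $0$. *)

(* Defs.v *)
From HB Require Import structures.
From mathcomp Require Import all_boot all_order all_algebra perm.
From mathcomp Require Import all_classical all_reals all_analysis.

Set Implicit Arguments.
Unset Strict Implicit.
Unset Printing Implicit Defensive.

Import Order.TTheory GRing.Theory Num.Theory.
Import numFieldNormedType.Exports.

Local Open Scope classical_set_scope.
Local Open Scope ring_scope.

(* Random vectors are row vectors, i.e. the transposes of column vectors, and
   processes are indexed from 0: [W i] stands for W_{i+1}.  The number of
   sources is written K.+1, since it is at least 1. *)

Section Processes.
Context {R : realType} {K : nat}.

Definition cylinders : set (set (nat -> 'rV[R]_K)) :=
  [set A | exists (i : nat) (k : 'I_K) (B : set R),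
     measurable B /\ A = [set x : nat -> 'rV[R]_K | B (x i 0 k)]].

(* the product sigma-algebra of (R^K)^nat, R^K carrying its Borel sets *)
Definition path_sigma_algebra : set (set (nat -> 'rV[R]_K)) := <<s cylinders >>.

Definition path_shift (x : nat -> 'rV[R]_K) : nat -> 'rV[R]_K := fun i => x i.+1.

Context {d : measure_display} {T : measurableType d} (P : probability T R).
Variable W : nat -> T -> 'rV[R]_K.

Definition sample_path (w : T) : nat -> 'rV[R]_K := fun i => W i w.

Definition random_process : Prop :=
  forall (i : nat) (k : 'I_K), measurable_fun [set: T] (fun w => W i w 0 k).

Definition stationary : Prop := forall A, path_sigma_algebra A ->
  P (sample_path @^-1` (path_shift @^-1` A)) = P (sample_path @^-1` A).

Definition ergodic : Prop := forall A, path_sigma_algebra A ->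
  path_shift @^-1` A = A ->
  P (sample_path @^-1` A) = 0%E \/ P (sample_path @^-1` A) = 1%E.

End Processes.

Section Marginal.
Context {R : realType} {K : nat}.
Context {d : measure_display} {T : measurableType d} (P : probability T R).

(* the support of the law of X; balls of 'rV[R]_K are those of the sup norm *)
Definition law_support (X : T -> 'rV[R]_K) : set 'rV[R]_K :=
  [set a | forall e : R, 0 < e -> (0 < P (X @^-1` ball a e))%E].

(* meaningful when the coordinates of X are integrable *)
Definition mean_vector (X : T -> 'rV[R]_K) : 'rV[R]_K :=
  \row_k fine 'E_P[fun w => X w 0 k].

(* Convergence in probability to 0, stated with the outer measure P^* so that
   it makes sense for functions that are not measurable; P^* and P coincide on
   measurable sets. *)
Definition cvg_in_probability0 (X : nat -> T -> R) : Prop :=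
  forall e : R, 0 < e ->
    (P^*)%mu [set w | e < `|X n w|] @[n --> \oo] --> 0%E.

End Marginal.

Section Geometry.
Context {R : realType} {J : nat}.

Definition conv_hull (A : set 'rV[R]_J) : set 'rV[R]_J :=
  smallest [set C | convex_set (M := 'rV[R]_J) C] A.

(* k-dimensional volume of the convex hull of the k+1 rows of V *)
Definition simplex_volume {k : nat} (V : 'M[R]_(k.+1, J)) : R :=
  let A := \matrix_(i < k, j < J) (V (lift ord0 i) j - V ord0 j) in
  Num.sqrt `|\det (A *m A^T)| / (k`!)%:R.

Definition max_volume_points {k : nat} (S : set 'rV[R]_J)
    (V : 'M[R]_(k.+1, J)) : Prop :=
  (forall i, S (row i V)) /\
  (forall V' : 'M[R]_(k.+1, J), (forall i, S (row i V')) ->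
     simplex_volume V' <= simplex_volume V).

Definition row_total (y : 'rV[R]_J) : R := \sum_j y 0 j.

Definition normalize_row (y : 'rV[R]_J) : 'rV[R]_J := (row_total y)^-1 *: y.

End Geometry.

Section MoorePenrose.
Context {R : realType}.

Definition is_moore_penrose {m n : nat} (A : 'M[R]_(m, n)) (B : 'M[R]_(n, m)) :=
  [/\ A *m B *m A = A, B *m A *m B = B,
      (A *m B)^T = A *m B & (B *m A)^T = B *m A].

Definition moore_penrose {m n : nat} (A : 'M[R]_(m, n)) : 'M[R]_(n, m) :=
  xget 0 [set B | is_moore_penrose A B].

Lemma mulmx_tr_eq0 {m n : nat} (A : 'M[R]_(m, n)) : A *m A^T = 0 -> A = 0.
Proof.
move=> A0; apply/matrixP => i j; move/matrixP/(_ i i): A0; rewrite !mxE.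
move/eqP; rewrite psumr_eq0; last by move=> k _; rewrite mxE -expr2 sqr_ge0.
by move/allP/(_ j (mem_index_enum _)); rewrite mxE mulf_eq0 orbb => /eqP.
Qed.

Lemma row_free_gram {m n : nat} (A : 'M[R]_(m, n)) :
  row_free A -> A *m A^T \in unitmx.
Proof.
move=> fA; rewrite -row_free_unit -kermx_eq0; apply/eqP/(row_free_inj fA).
rewrite mul0mx; apply: mulmx_tr_eq0.
by rewrite trmx_mul mulmxA -(mulmxA _ A) mulmx_ker mul0mx.
Qed.

Lemma moore_penrose_factor {m n r : nat} (C : 'M[R]_(m, r)) (F : 'M[R]_(r, n)) :
  row_free C^T -> row_free F -> exists B, is_moore_penrose (C *m F) B.
Proof.
move=> fC fF.
have uF : F *m F^T \in unitmx by exact: row_free_gram.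
have uC : C^T *m C \in unitmx by rewrite -{2}[C]trmxK row_free_gram.
have sF : (invmx (F *m F^T))^T = invmx (F *m F^T).
  by rewrite trmx_inv trmx_mul trmxK.
have sC : (invmx (C^T *m C))^T = invmx (C^T *m C).
  by rewrite trmx_inv trmx_mul trmxK.
pose G := F^T *m invmx (F *m F^T); pose D := invmx (C^T *m C) *m C^T.
have FG : F *m G = 1%:M by rewrite mulmxA mulmxV.
have DC : D *m C = 1%:M by rewrite -mulmxA mulVmx.
have AB : (C *m F) *m (G *m D) = C *m D by rewrite -mulmxA (mulmxA F) FG mul1mx.
have BA : G *m D *m (C *m F) = G *m F by rewrite -mulmxA (mulmxA D) DC mul1mx.
exists (G *m D); split.
- by rewrite AB -mulmxA (mulmxA D) DC mul1mx.
- by rewrite BA mulmxA -(mulmxA G F) FG mulmx1.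
- by rewrite AB /D !trmx_mul trmxK sC mulmxA.
- by rewrite BA /G !trmx_mul trmxK sF mulmxA.
Qed.

Lemma moore_penroseP {m n : nat} (A : 'M[R]_(m, n)) :
  is_moore_penrose A (moore_penrose A).
Proof.
apply: (xgetPex 0 (P := is_moore_penrose A)).
rewrite -(mulmx_base A); apply: moore_penrose_factor (row_base_free A).
by rewrite /row_free mxrank_tr; exact: col_base_full.
Qed.

Lemma is_moore_penrose_uniq {m n : nat} (A : 'M[R]_(m, n)) B1 B2 :
  is_moore_penrose A B1 -> is_moore_penrose A B2 -> B1 = B2.
Proof.
move=> [a1 b1 c1 d1] [a2 b2 c2 d2].
have E1 : A *m B1 = A *m B2.
  rewrite -{1}a2 -mulmxA -c2 -c1 -trmx_mul mulmxA.
  by rewrite a1 c2.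
have E2 : B1 *m A = B2 *m A.
  rewrite -{1}a2 !mulmxA -(mulmxA (B1 *m A)) -d1 -d2 -trmx_mul.
  by rewrite -mulmxA (mulmxA A) a1 d2.
by rewrite -b1 E2 -mulmxA E1 mulmxA b2.
Qed.

End MoorePenrose.

Section Attribution.
Context {R : realType} {K J : nat}.

Definition augment (M : 'M[R]_(K, J)) : 'M[R]_(K, J + 1) :=
  row_mx M (const_mx 1).

Definition aug_right_inverse (M : 'M[R]_(K, J)) : 'M[R]_(J + 1, K) :=
  (augment M)^T *m moore_penrose (augment M *m (augment M)^T).

Definition sample_mean {V : lmodType R} (n : nat) (y : nat -> V) : V :=
  n%:R^-1 *: \sum_(i < n) y i.

Definition mean_estimator (n : nat) (y : nat -> 'rV[R]_J) (Hstar : 'M[R]_(K, J)) :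
    'rV[R]_K :=
  row_mx (sample_mean n y)
         (const_mx (sample_mean (V := R^o) n (fun i => row_total (y i))))
    *m aug_right_inverse Hstar.

(* As x / 0 = 0, an entry with a vanishing denominator is 0. *)
Definition attribution_matrix (m : 'rV[R]_K) (H : 'M[R]_(K, J)) : 'M[R]_(K, J) :=
  \matrix_(k, j) (m 0 k * H k j / \sum_l m 0 l * H l j).

Definition is_norm (N : 'M[R]_(K, J) -> R) : Prop :=
  [/\ forall A, 0 <= N A,
      forall A, N A = 0 -> A = 0,
      forall a A, N (a *: A) = `|a| * N A &
      forall A B, N (A + B) <= N A + N B].

(* The default value of the iterated minimum is the term of the identity
   permutation, so this is the minimum over all permutations. *)
Definition perm_distance (N : 'M[R]_(K, J) -> R) (A B : 'M[R]_(K, J)) : R :=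
  \big[Num.min/N (A - B)]_(s : 'S_K) N (perm_mx s *m A - B).

End Attribution.

(* Main.v *)
Require Import Defs.

From mathcomp Require Import all_boot all_order all_algebra perm.
From mathcomp Require Import all_classical all_reals all_analysis.
From mathcomp Require Import measurable_realfun ring lra.

Set Implicit Arguments.
Unset Strict Implicit.
Unset Printing Implicit Defensive.

Import Order.TTheory GRing.Theory Num.Theory.
Import numFieldNormedType.Exports.

Local Open Scope classical_set_scope.
Local Open Scope ring_scope.

(** Write H = diag(h) M, where h_k is the total of row k of H and the rows of M
are the rows of H normalized to total 1.  A normalized observation is then
lambda M, where lambda, proportional to W_i diag(h), is a probability vector.
All the points of S_n therefore lie in the simplex spanned by the rows of M, and
the chosen points are the rows of L M for a row-stochastic matrix L.

The volume of the simplex with vertices the rows of L M is |det L| times that of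
the rows of M ([simplex_volumeM]), and the latter is positive because M has full
row rank.  Ergodicity and separability make the process visit every
neighbourhood of every c_k e_k ([visit_vanishing]), so with probability tending
to 1 every row of M has a point of S_n close to it, and maximality of the
volume forces |det L| to be close to 1.  For a row-stochastic matrix, that
happens only near a permutation matrix ([near_permutation]).

Since the rows of L and of M have total 1, the right inverse defining the mean
estimator m gives exactly m L = Wbar diag(h), where Wbar is the sample mean of
the W_i ([mean_estimatorE]).  The estimated attribution matrix is thus an
explicit function of Wbar and L.  Permuting its rows amounts to permuting the
rows of L, so L may be taken near the identity, where this function is
continuous ([attribution_stability]); at (mu, 1) its value is the attribution
matrix of mu and H.  It remains to know that Wbar is close to mu with
probability tending to 1.

Both probabilistic inputs, the law of large numbers for Wbar and the visits near
c_k e_k, follow from one inequality, [ergodic_upper_bound]: for an ergodic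
measure-preserving map and an integrable f of mean less than a, the probability
that the n-th Birkhoff sum of f exceeds n a tends to 0.  It is applied to the
coordinates, to their opposites, and to minus the indicator of a ball. *)

(** * A one-sided ergodic theorem *)

Section ErgodicTheorem.
Context {R : realType} {d : measure_display} {T : measurableType d}.
Variables (P : probability T R) (theta : T -> T).
Hypothesis mtheta : measurable_fun [set: T] theta.
Hypothesis theta_preserving :
  forall A, measurable A -> P (theta @^-1` A) = P A.
Hypothesis theta_ergodic : forall A, measurable A -> theta @^-1` A = A ->
  P A = 0%E \/ P A = 1%E.

Lemma integrable_comp_preserving (f : T -> R) :
  P.-integrable [set: T] (EFin \o f) ->
  P.-integrable [set: T] (EFin \o (f \o theta)) /\
  (\int[P]_x (f (theta x))%:E = \int[P]_x (f x)%:E)%E.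
Proof.
move=> intf.
have mf : measurable_fun [set: T] (EFin \o f) by case/integrableP: intf.
have E (g : T -> \bar R) : (\int[pushforward P theta]_x g x = \int[P]_x g x)%E.
  apply: eq_measure_integral => A mA _ /=.
  by rewrite /pushforward theta_preserving.
have intc : P.-integrable [set: T] (EFin \o (f \o theta)).
  apply/integrableP; split; first exact: (measurableT_comp mf).
  case/integrableP: intf => _; rewrite -E.
  rewrite ge0_integral_pushforward //; exact: measurableT_comp mf.
split=> //.
by rewrite -[RHS]E integral_pushforward.
Qed.

(** The maximum of the Birkhoff sums of lengths 0 to n, in the recursive form
that makes its behaviour under theta immediate. *)
Fixpoint sum_max (g : T -> R) (n : nat) (x : T) : R :=
  if n is m.+1 then Num.max 0 (g x + sum_max g m (theta x)) else 0.

Section SumMax.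
Variable g : T -> R.
Hypothesis intg : P.-integrable [set: T] (EFin \o g).

Lemma sum_max_ge0 n x : 0 <= sum_max g n x.
Proof. by case: n => //= n; rewrite le_max lexx. Qed.

Lemma sum_max_ndecr n x : sum_max g n x <= sum_max g n.+1 x.
Proof.
elim: n x => [|n IHn] x; first exact: sum_max_ge0.
by rewrite /= ge_max le_max lexx /= le_max lerD2l IHn orbT.
Qed.

Lemma sum_max_homo x m n : (m <= n)%N -> sum_max g m x <= sum_max g n x.
Proof.
elim: n => [|n IHn]; first by rewrite leqn0 => /eqP ->.
rewrite leq_eqVlt => /predU1P[->//|]; rewrite ltnS => /IHn h.
exact: le_trans h (sum_max_ndecr n x).
Qed.

Lemma birkhoff_sum_le_max n x :
  \sum_(i < n) g (iter i theta x) <= sum_max g n x.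
Proof.
elim: n x => [|n IHn] x; first by rewrite big_ord0.
rewrite big_ord_recl /= le_max; apply/orP; right.
apply: lerD => //; apply: le_trans (IHn _).
by apply: ler_sum => i _; rewrite -iterSr.
Qed.

Lemma measurable_sum_max n : measurable_fun [set: T] (sum_max g n).
Proof.
have mg : measurable_fun [set: T] g.
  by case/integrableP: intg => /measurable_EFinP.
elim: n => [|n IHn] /=; first exact: measurable_cst.
apply: measurable_maxr; first exact: measurable_cst.
by apply: measurable_funD => //; exact: measurableT_comp.
Qed.

Lemma integrable_sum_max n : P.-integrable [set: T] (EFin \o sum_max g n).
Proof.
elim: n => [|n IHn]; first by apply: integrable0.
have [intc _] := integrable_comp_preserving IHn.
apply: (le_integrable _ _ _ (integrableD _ intg intc)) => //.
- by apply/measurable_EFinP; exact: measurable_sum_max.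
- move=> x _ /=; rewrite lee_fin ger0_norm ?le_max ?lexx //.
  by rewrite ge_max normr_ge0 ler_norm.
Qed.

Definition unbounded_sums : set T := [set x | forall m, exists n, m%:R < sum_max g n x].

Lemma unbounded_sumsE :
  unbounded_sums = \bigcap_m \bigcup_n [set x | m%:R < sum_max g n x].
Proof.
apply/seteqP; split=> x h m; first by move=> _; have [n hn] := h m; exists n.
by have [n _ hn] := h m I; exists n.
Qed.

Lemma measurable_sum_max_gt a n : measurable [set x | a < sum_max g n x].
Proof.
rewrite -[X in measurable X]setTI.
have -> : [set x | a < sum_max g n x] = sum_max g n @^-1` `]a, +oo[%classic.
  by apply/seteqP; split=> x /=; rewrite in_itv /= andbT.
by apply: measurable_sum_max.
Qed.

Lemma measurable_unbounded_sums : measurable unbounded_sums.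
Proof.
rewrite unbounded_sumsE; apply: bigcapT_measurable => m.
by apply: bigcupT_measurable => n; exact: measurable_sum_max_gt.
Qed.

(** As M_(n+1) = max (0, g + M_n o theta), the sequence M_n is unbounded at x if
and only if it is unbounded at theta x. *)
Lemma unbounded_sums_invariant : theta @^-1` unbounded_sums = unbounded_sums.
Proof.
apply/seteqP; split=> x h m /=.
  have [n hn] := h (Num.truncn (m%:R - g x)).+1.
  exists n.+1; rewrite /= lt_max; apply/orP; right.
  rewrite addrC -ltrBlDr; apply: lt_trans hn; exact: truncnS_gt.
have [n hn] := h (Num.truncn (`|g x| + m%:R)).+1.
have {hn}: `|g x| + m%:R < sum_max g n x by apply: lt_trans hn; exact: truncnS_gt.
case: n => [|n] /=.
  by rewrite ltNge addr_ge0.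
rewrite lt_max => /orP[|hn]; last first.
  exists n; rewrite -(ltrD2l (g x)); apply: le_lt_trans hn.
  by rewrite lerD2r ler_norm.
by rewrite ltNge addr_ge0.
Qed.

(** The maximal ergodic argument.  By invariance, the integral of
M_(n+1) - M_n o theta = max (- M_n o theta, g) is that of M_(n+1) - M_n, hence
nonnegative.  If M_n were almost surely unbounded, these functions would
converge to g while staying dominated by |g|, and g would have a nonnegative
integral. *)
Lemma unbounded_sums_null :
  (\int[P]_x (g x)%:E < 0)%E -> P unbounded_sums = 0%E.
Proof.
move=> g_lt0.
have [//|PA1] := theta_ergodic measurable_unbounded_sums unbounded_sums_invariant.
exfalso.
have mg : measurable_fun [set: T] (EFin \o g) by case/integrableP: intg.
pose h n x := Num.max (- sum_max g n (theta x)) (g x).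
have hE n x : h n x = sum_max g n.+1 x - sum_max g n (theta x).
  by rewrite /h /= [RHS]addrC addr_maxr addr0 addrCA addNr addr0.
have hint n : (0 <= \int[P]_x (h n x)%:E)%E.
  have i1 := integrable_sum_max n.+1.
  have [i2 e2] := integrable_comp_preserving (integrable_sum_max n).
  under eq_integral do rewrite hE EFinB.
  rewrite integralB_EFin // e2 sube_ge0; last first.
    by apply/orP; left; exact: (integrable_fin_num measurableT (integrable_sum_max n)).
  apply: le_integral => //; first exact: integrable_sum_max.
  by move=> x _; rewrite lee_fin; exact: sum_max_ndecr.
have ighost : P.-integrable [set: T] (fun x => `|(g x)%:E|%E).
  exact: integrable_abse intg.
have [|||_ _ cvh] := @dominated_convergence _ _ _ P setT measurableT
  (fun n x => (h n x)%:E) (EFin \o g) (fun x => `|(g x)%:E|%E) _ mg _ ighost _.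
- move=> n; apply/measurable_EFinP; apply: measurable_maxr.
    apply: measurableT_comp => //; apply: measurableT_comp mtheta.
    exact: measurable_sum_max.
  exact/measurable_EFinP.
- have nA : P (~` unbounded_sums) = 0%E.
    rewrite probability_setC ?PA1 ?subee //; exact: measurable_unbounded_sums.
  exists (~` unbounded_sums); split=> //.
    by apply: measurableC; exact: measurable_unbounded_sums.
  move=> x; apply: contra_not => xA _.
  have {}xA : unbounded_sums (theta x).
    by move: xA; rewrite -{1}unbounded_sums_invariant.
  have [n hn] := xA (Num.truncn (- g x)).+1.
  apply: cvg_near_cst.
  exists n => // m /= nm; congr EFin; apply/max_idPr.
  rewrite lerNl ltW //; apply: lt_le_trans (sum_max_homo _ nm).
  by apply: lt_trans hn; exact: truncnS_gt.
- apply: aeW => x n _; rewrite lee_fin /h /Num.max.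
  case: ifPn => // gM; rewrite -leNgt in gM.
  rewrite normrN (ger0_norm (sum_max_ge0 _ _)).
  rewrite lerNr in gM; apply: (le_trans gM).
  by rewrite -normrN ler_norm.
have : (0 <= \int[P]_x (EFin \o g) x)%E.
  rewrite -(cvg_lim _ cvh) //; apply: lime_ge.
    by apply/cvg_ex; eexists; exact: cvh.
  exact: nearW.
by rewrite leNgt g_lt0.
Qed.

(** The events that some M_m exceeds n eps decrease with n to a subset of the
null set where M_m is unbounded. *)
Lemma sum_max_linear_growth (eps : R) : 0 < eps ->
  (\int[P]_x (g x)%:E < 0)%E ->
  P [set x | n%:R * eps < sum_max g n x] @[n --> \oo] --> 0%E.
Proof.
move=> eps0 g_lt0.
pose D n := \bigcup_m [set x | n%:R * eps < sum_max g m x].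
have mD n : measurable (D n).
  by apply: bigcupT_measurable => m; exact: measurable_sum_max_gt.
have mcD : measurable (\bigcap_n D n) by exact: bigcapT_measurable.
have PD0 : P (\bigcap_n D n) = 0%E.
  apply/eqP; rewrite eq_le measure_ge0 andbT -(unbounded_sums_null g_lt0).
  apply: le_measure; rewrite ?inE //; first exact: measurable_unbounded_sums.
  move=> x Dx m; have [k _ hk] := Dx (Num.truncn (m%:R / eps)).+1 I.
  exists k; apply: lt_trans hk.
  by rewrite -ltr_pdivrMr //; exact: truncnS_gt.
have cvD : (P \o D) n @[n --> \oo] --> 0%E.
  rewrite -PD0; apply: nonincreasing_cvg_mu => //.
    by rewrite (le_lt_trans (probability_le1 _ (mD _))) ?ltry.
  move=> m n mn; apply/subsetPset => x [k _ hk]; exists k => //.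
  by apply: le_lt_trans hk; rewrite ler_pM2r // ler_nat.
apply: (squeeze_cvge (f := cst 0%E) (h := P \o D)) => //; last exact: cvg_cst.
apply: nearW => n; rewrite measure_ge0 /=.
apply: le_measure; rewrite ?inE //; first exact: measurable_sum_max_gt.
by move=> x hx; exists n.
Qed.

End SumMax.

(** Subtracting from f a constant b with int f < b < a produces a function of
negative integral whose Birkhoff sums exceed n (a - b) on the event at hand. *)
Theorem ergodic_upper_bound (f : T -> R) (a : R) :
  P.-integrable [set: T] (EFin \o f) -> (\int[P]_x (f x)%:E < a%:E)%E ->
  P [set x | n%:R * a < \sum_(i < n) f (iter i theta x)] @[n --> \oo] --> 0%E.
Proof.
move=> intf fa.
have fin_f := integrable_fin_num measurableT intf.
set r := fine (\int[P]_x (f x)%:E); have Er : (\int[P]_x (f x)%:E)%E = r%:E.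
  by rewrite /r fineK.
rewrite Er lte_fin in fa.
pose b := (r + a) / 2; pose g x := f x - b.
have intb : P.-integrable [set: T] (EFin \o cst b).
  exact: finite_measure_integrable_cst.
have intg : P.-integrable [set: T] (EFin \o g).
  by apply: eq_integrable (integrableB measurableT intf intb) => // x _ /=.
have g_lt0 : (\int[P]_x (g x)%:E < 0)%E.
  under eq_integral do rewrite EFinB.
  rewrite integralB_EFin // Er integral_cst //.
  rewrite [X in (_ * X)%E]probability_setT mule1 -EFinB.
  by rewrite lte_fin /b; lra.
have eps0 : 0 < a - b by rewrite /b; lra.
have h := sum_max_linear_growth intg eps0 g_lt0.
apply: (squeeze_cvge (f := cst 0%E) _ _ h); last exact: cvg_cst.
apply: nearW => n; rewrite measure_ge0 /=.
have mf : measurable_fun [set: T] f.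
  by case/integrableP: intf => /measurable_EFinP.
apply: le_measure; rewrite ?inE //; last 1 first.
- move=> x /= hx; apply: lt_le_trans (birkhoff_sum_le_max _ _ _).
  rewrite sumrB sumr_const card_ord -[b *+ n]mulr_natl mulrBr.
  by rewrite ltrD2r.
- rewrite -[X in measurable X]setTI.
  have -> : [set x | n%:R * a < \sum_(i < n) f (iter i theta x)] =
     (fun x => \sum_(i < n) f (iter i theta x)) @^-1` `]n%:R * a, +oo[%classic.
    by apply/seteqP; split=> x /=; rewrite in_itv /= andbT.
  have miter i : measurable_fun [set: T] (iter i theta).
    elim: i => [|i IHi]; first exact: measurable_id.
    exact: (measurableT_comp mtheta IHi).
  have m : measurable_fun setT (fun x => \sum_(i < n) f (iter i theta x)).
    by apply: measurable_sum => i; exact: (measurableT_comp mf (miter i)).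
  exact: m.
- exact: measurable_sum_max_gt.
Qed.

End ErgodicTheorem.
(** * Row-stochastic matrices of determinant close to one *)

Section StochasticMatrices.
Context {R : realType} {n : nat}.
Implicit Types L : 'M[R]_n.

Definition row_stochastic {m : nat} (L : 'M[R]_(m, n)) : Prop :=
  (forall i k, 0 <= L i k) /\ (forall i, \sum_k L i k = 1).

Lemma row_stochastic_le1 {m} (L : 'M[R]_(m, n)) i k : row_stochastic L -> L i k <= 1.
Proof.
move=> [L0 L1]; rewrite -(L1 i) (bigD1 k) //= lerDl.
by apply: sumr_ge0 => l _; exact: L0.
Qed.

(** Expanding the product of the row sums, 1 is the sum of the products
prod_i L i (g i) over all maps g.  The permutations alone contribute the
permanent of L, which bounds |det L|; a non-injective f contributes one more
term. *)
Lemma row_stochastic_perm_prod L (f : {ffun 'I_n -> 'I_n}) :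
  row_stochastic L -> ~ injective f ->
  `|\det L| + \prod_i L i (f i) <= 1.
Proof.
move=> [L0 L1] finj.
pose p (g : {ffun 'I_n -> 'I_n}) := \prod_i L i (g i).
have p0 g : 0 <= p g by apply: prodr_ge0 => i _; exact: L0.
pose h (s : 'S_n) : {ffun 'I_n -> 'I_n} := [ffun i => s i].
have hinj : injective h.
  by move=> s t /ffunP st; apply/permP => i; have := st i; rewrite !ffunE.
have detle : `|\det L| <= \sum_s p (h s).
  apply: (le_trans (ler_norm_sum _ _ _)); apply: ler_sum => s _.
  rewrite normrM normrX normrN1 expr1n mul1r ger0_norm; last first.
    by apply: prodr_ge0 => i _; exact: L0.
  by rewrite /p; under [leRHS]eq_bigr do rewrite ffunE.
apply: (le_trans (lerD detle (lexx _))).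
have E1 : \sum_(g : {ffun 'I_n -> 'I_n}) p g = 1.
  rewrite -(bigA_distr_bigA (fun i k => L i k)) /=.
  by apply: big1 => i _; exact: L1.
rewrite -/(p f) -[leRHS]E1 (bigID [in h @: predT]) /=; apply: lerD.
  rewrite big_imset /=; last by move=> s t _ _ /hinj.
  by rewrite (eq_bigl predT).
rewrite (bigD1 f) /=; first by rewrite lerDl; apply: sumr_ge0 => g _; exact: p0.
apply/imsetP => -[s _ fs]; apply: finj => i j.
by rewrite fs !ffunE => /perm_inj.
Qed.

(** Take the permutation s with the largest product p, so that p n! is at least
|det L|.  Redirecting i from s i to another k gives a non-injective map, whose
product is at least L i k p, and which is at most e by the previous lemma. *)
Lemma row_stochastic_det_perm L (e : R) : row_stochastic L ->
  1 - e <= `|\det L| ->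
  exists s : 'S_n, forall i k, k != s i -> L i k * (1 - e) <= n`!%:R * e.
Proof.
move=> sL le_det; have [L0 L1] := sL.
pose p (s : 'S_n) := \prod_i L i (s i).
have p0 s : 0 <= p s by apply: prodr_ge0 => i _; exact: L0.
have [s smax] : exists s, forall t, p t <= p s.
  exists [arg max_(s > (1%g : 'S_n)) p s]%O; case: arg_maxP => // s _ hs t; exact: hs.
have ps : 1 - e <= n`!%:R * p s.
  apply: (le_trans le_det); apply: (le_trans (ler_norm_sum _ _ _)).
  apply: (@le_trans _ _ (\sum_(t : 'S_n) p s)).
    apply: ler_sum => t _.
    by rewrite normrM normrX normrN1 expr1n mul1r ger0_norm ?p0 // smax.
  by rewrite sumr_const -[in leRHS]card_Sn mulr_natl.
exists s => i k ki.
apply: (@le_trans _ _ (L i k * (n`!%:R * p s))); first exact: ler_wpM2l.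
rewrite mulrCA ler_wpM2l ?ler0n //.
pose f : {ffun 'I_n -> 'I_n} := [ffun j => if j == i then k else s j].
have finj : ~ injective f.
  move=> /(_ i ((s^-1)%g k)); rewrite !ffunE eqxx permKV if_same => /(_ erefl) ik.
  by move: ki; rewrite {1}[in s i]ik permKV eqxx.
have := row_stochastic_perm_prod sL finj.
rewrite (bigD1 i) //= ffunE eqxx.
under eq_bigr => j /negPf ji do rewrite ffunE ji.
set q := \prod_(j < n | _) _ => le1.
have ps_le : p s <= q.
  rewrite /p (bigD1 i) //= ler_piMl ?row_stochastic_le1 //.
  by apply: prodr_ge0 => j _; exact: L0.
have : L i k * p s <= L i k * q by exact: ler_wpM2l.
by lra.
Qed.

Lemma near_permutation (eta : R) : 0 < eta ->
  exists2 e : R, 0 < e & forall L, row_stochastic L -> 1 - e <= `|\det L| ->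
    exists s : 'S_n, forall i k, `|L i k - (k == s i)%:R| <= eta.
Proof.
move=> eta0.
(* This e satisfies e <= 1/2 and e c <= eta; the off-diagonal bound 2 n! e is
   then at most eta / (n + 1), so that n such entries add up to at most eta. *)
pose c : R := n.+1%:R * n`!%:R *+ 2.
have c0 : 0 < c by rewrite mulrn_wgt0 // mulr_gt0 ?ltr0n ?fact_gt0.
exists (eta / (c + eta *+ 2)); first by rewrite divr_gt0 // addr_gt0 // mulrn_wgt0.
set e := eta / _ => L sL le_det; have [L0 L1] := sL.
have eE : e * (c + eta *+ 2) = eta.
  by rewrite divfK // gt_eqF // addr_gt0 // mulrn_wgt0.
have e0 : 0 < e by rewrite divr_gt0 // addr_gt0 // mulrn_wgt0.
have e2 : e <= 2^-1.
  rewrite /e ler_pdivrMr ?addr_gt0 ?mulrn_wgt0 //; lra.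
have [s hs] := row_stochastic_det_perm sL le_det.
have off i k : k != s i -> L i k * n.+1%:R <= eta.
  move=> ki; have h1 := hs i k ki; have Lk := L0 i k.
  have h2 : L i k <= n`!%:R * e *+ 2 by nra.
  apply: (@le_trans _ _ (e * c)); last first.
    by rewrite -[leRHS]eE ler_wpM2l ?ltW // ltrDl mulrn_wgt0.
  have -> : e * c = n`!%:R * e *+ 2 * n.+1%:R by rewrite /c; ring.
  by rewrite ler_wpM2r.
have n1 : 1 <= n.+1%:R :> R by rewrite ler1n.
exists s => i k; have [->|ki] := eqVneq k (s i); last first.
  rewrite subr0 ger0_norm //; apply: le_trans (off i k ki).
  by rewrite ler_peMr.
rewrite distrC ger0_norm; last by rewrite subr_ge0 row_stochastic_le1.
rewrite -[X in X - _](L1 i) (bigD1 (s i)) //= addrAC subrr add0r.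
rewrite -(@ler_pM2r _ n.+1%:R) ?ltr0n // mulr_suml.
apply: (@le_trans _ _ (\sum_(l | l != s i) eta)); first by apply: ler_sum => l; exact: off.
rewrite sumr_const mulr_natr; apply: ler_wpMn2l; first exact: ltW.
by apply: (leq_trans (max_card _)); rewrite card_ord.
Qed.

End StochasticMatrices.

(** * The volume of a simplex with vertices in another simplex *)

Section SimplexVolume.
Context {R : realType} {k J : nat}.
Implicit Types (V : 'M[R]_(1 + k, J)) (L : 'M[R]_(1 + k)).

(* D V lists the edges of the simplex V issued from its first vertex; E is a
   right inverse of D. *)
Let D : 'M[R]_(k, 1 + k) := row_mx (const_mx (-1)) 1%:M.
Let E : 'M[R]_(1 + k, k) := col_mx 0 1%:M.

Lemma simplex_edgesE V :
  (\matrix_(i < k, j < J) (V (lift ord0 i) j - V ord0 j)) = D *m V.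
Proof.
rewrite -[V in RHS]vsubmxK mul_row_col mul1mx; apply/matrixP => i j.
rewrite !mxE big_ord1 !mxE mulN1r addrC rshift1; congr (_ - V _ _).
by apply/val_inj.
Qed.

Lemma simplex_edges_ED : E *m D = 1%:M - col_mx 1%:M (const_mx 1) *m row_mx 1%:M 0.
Proof.
rewrite !mul_col_row ?mul0mx ?mul1mx ?mulmx0 ?mulmx1.
rewrite (scalar_mx_block 1 k 1) opp_block_mx add_block_mx subrr !subr0 sub0r.
by congr block_mx; apply/matrixP => i j; rewrite !mxE.
Qed.

(** As D kills the vector of ones and L fixes it, D L = L' D for a k x k matrix
L', so that the Gram matrix of the edges becomes L' G L'^T.  In the basis given
by e_0 and D, the matrix L is block triangular with diagonal blocks 1 and L',
whence det L' = det L. *)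
Lemma simplex_volumeM V L : (forall i, \sum_l L i l = 1) ->
  @simplex_volume R J k (L *m V) = `|\det L| * @simplex_volume R J k V.
Proof.
move=> L1.
pose e0 : 'M[R]_(1, 1 + k) := row_mx 1%:M 0.
have L11 : L *m col_mx 1%:M (const_mx 1) = col_mx 1%:M (const_mx 1).
  have -> : col_mx 1%:M (const_mx 1) = (const_mx 1 : 'cV[R]_(1 + k)).
    by rewrite -[RHS]vsubmxK; congr col_mx; apply/matrixP => i j; rewrite !mxE ?eqxx // ord1 ord1.
  apply/matrixP => i j; rewrite !mxE -[RHS](L1 i).
  by apply: eq_bigr => l _; rewrite mxE mulr1.
have D1 : D *m col_mx 1%:M (const_mx 1) = 0.
  by rewrite mul_row_col mul1mx mulmx1 -[LHS]addrC; apply/matrixP => i j; rewrite !mxE subrr.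
pose L' := D *m L *m E.
have DL : D *m L = L' *m D.
  rewrite -[RHS]mulmxA simplex_edges_ED mulmxBr mulmx1 mulmxA -[D *m L *m _]mulmxA.
  by rewrite L11 D1 mul0mx subr0.
pose B := block_mx (1%:M : 'M[R]_1) (e0 *m L *m E) 0 L'.
pose U := col_mx e0 D.
have detU : \det U = 1 by rewrite /U /e0 /D det_lblock !det1 mul1r.
have UL : U *m L = B *m U.
  rewrite mul_col_mx /B /U mul_block_col mul1mx mul0mx add0r DL; congr col_mx.
  rewrite -[X in _ + X]mulmxA simplex_edges_ED mulmxBr mulmx1 mulmxA.
  rewrite -[e0 *m L *m _ in X in _ + (_ - X)]mulmxA L11.
  by rewrite {2}/e0 mul_row_col mul0mx addr0 mulmx1 mul1mx addrC subrK.
have detL : \det L' = \det L.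
  have := congr1 (determinant (n := _)) UL.
  by rewrite !det_mulmx detU det_ublock det1 !mul1r mulr1.
rewrite /simplex_volume !simplex_edgesE.
have -> : D *m (L *m V) = L' *m (D *m V) by rewrite mulmxA DL mulmxA.
set X := D *m V; rewrite trmx_mul mulmxA -(mulmxA L'); set G := X *m _.
rewrite 2!det_mulmx det_tr detL mulrAC -expr2 normrM.
by rewrite sqrtrM // normrX sqrtr_sqr normr_id mulrA.
Qed.

Lemma simplex_volume_gt0 V : row_free V -> 0 < @simplex_volume R J k V.
Proof.
move=> /row_freeP [B VB]; rewrite /simplex_volume simplex_edgesE.
rewrite divr_gt0 ?ltr0n ?fact_gt0 // sqrtr_gt0 normr_gt0 -unitfE -unitmxE.
apply: row_free_gram; apply/row_freeP; exists (B *m E).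
by rewrite mulmxA -[D *m V *m B]mulmxA VB mulmx1 mul_row_col mulmx0 add0r mul1mx.
Qed.

End SimplexVolume.
(** * Entrywise limits of matrix expressions *)

Section EntrywiseLimits.
Context {R : realType} {U : Type} (F : set_system U).
Context {FF : Filter F}.

Lemma cvg_sumr {I : Type} (r : seq I) (Q : pred I) (f : I -> U -> R) (l : I -> R) :
  (forall i, Q i -> f i x @[x --> F] --> l i) ->
  \sum_(i <- r | Q i) f i x @[x --> F] --> \sum_(i <- r | Q i) l i.
Proof. by move=> fl; apply: cvg_big => //; exact: add_continuous. Qed.

Lemma cvg_prodr {I : Type} (r : seq I) (Q : pred I) (f : I -> U -> R) (l : I -> R) :
  (forall i, Q i -> f i x @[x --> F] --> l i) ->
  \prod_(i <- r | Q i) f i x @[x --> F] --> \prod_(i <- r | Q i) l i.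
Proof. by move=> fl; apply: cvg_big => //; exact: mul_continuous. Qed.

Definition entrywise_cvg {m n} (A : U -> 'M[R]_(m, n)) (B : 'M[R]_(m, n)) :=
  forall i j, A x i j @[x --> F] --> B i j.

Lemma entrywise_cvgM {m n p} (A : U -> 'M[R]_(m, n)) A0 (B : U -> 'M[R]_(n, p)) B0 :
  entrywise_cvg A A0 -> entrywise_cvg B B0 ->
  entrywise_cvg (fun x => A x *m B x) (A0 *m B0).
Proof.
move=> cA cB i j; rewrite mxE.
under eq_cvg do rewrite mxE.
by apply: cvg_sumr => k _; apply: cvgM; [exact: cA|exact: cB].
Qed.

Lemma entrywise_cvg_det {n} (A : U -> 'M[R]_n) A0 :
  entrywise_cvg A A0 -> \det (A x) @[x --> F] --> \det A0.
Proof.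
move=> cA; apply: cvg_sumr => s _; apply: cvgM; first exact: cvg_cst.
by apply: cvg_prodr => i _; exact: cA.
Qed.

(** Cramer's formula, valid eventually since the determinant converges to a
nonzero limit. *)
Lemma entrywise_cvg_invmx {n} (A : U -> 'M[R]_n) A0 :
  A0 \in unitmx -> entrywise_cvg A A0 ->
  entrywise_cvg (fun x => invmx (A x)) (invmx A0).
Proof.
move=> uA0 cA i j.
have dA0 : \det A0 != 0 by rewrite -unitfE -unitmxE.
have cdet := entrywise_cvg_det cA.
have -> : invmx A0 i j = (\det A0)^-1 * cofactor A0 j i.
  by rewrite /invmx uA0 !mxE.
have near_unit : \forall x \near F, \det (A x) != 0.
  by apply: (cvgr_neq0 _ cdet).
have near_eq : \forall x \near F,
    (\det (A x))^-1 * cofactor (A x) j i = invmx (A x) i j.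
  apply: filterS near_unit => x dA.
  by rewrite /invmx unitmxE unitfE dA !mxE.
apply: (cvg_trans (near_eq_cvg near_eq)).
apply: cvgM; first exact: cvgV.
apply: cvgM; first exact: cvg_cst.
apply: entrywise_cvg_det => k l; rewrite !mxE.
by under eq_cvg do rewrite !mxE; exact: cA.
Qed.

Lemma entrywise_cvg_attribution {k J} (m : U -> 'rV[R]_k) (m0 : 'rV[R]_k)
    (H : U -> 'M[R]_(k, J)) (H0 : 'M[R]_(k, J)) :
  (forall j, \sum_l m0 0 l * H0 l j != 0) ->
  entrywise_cvg m m0 -> entrywise_cvg H H0 ->
  entrywise_cvg (fun x => attribution_matrix (m x) (H x)) (attribution_matrix m0 H0).
Proof.
move=> den cm cH i j; rewrite mxE.
under eq_cvg do rewrite mxE.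
apply: cvgM; first by apply: cvgM; [exact: cm|exact: cH].
apply: cvgV => //; apply: cvg_sumr => l _.
by apply: cvgM; [exact: cm|exact: cH].
Qed.

End EntrywiseLimits.

Lemma nbhs_mxP {R : realType} {m n : nat} (A : 'M[R]_(m, n)) (Q : set 'M[R]_(m, n)) :
  (\forall B \near A, Q B) <->
  exists2 e : R, 0 < e & forall B : 'M[R]_(m, n), (forall i j, `|B i j - A i j| <= e) -> Q B.
Proof.
split=> [/nbhs_ballP [e /= e0 h]|[e e0 h]].
  exists (e / 2); first by rewrite divr_gt0.
  move=> B hB; apply: h; split=> // i j; rewrite /ball /= distrC.
  by apply: le_lt_trans (hB i j) _; lra.
apply/nbhs_ballP; exists e => //= B [_ hB]; apply: h => i j.
by have := hB i j; rewrite /ball /= distrC; exact: ltW.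
Qed.

Lemma near_det1 {R : realType} {n : nat} (e : R) : 0 < e ->
  exists2 delta : R, 0 < delta & forall B : 'M[R]_n,
    (forall i j, `|B i j - (i == j)%:R| <= delta) -> 1 - e <= `|\det B|.
Proof.
move=> e0.
have c : \det (B : 'M[R]_n) @[B --> (1%:M : 'M[R]_n)] --> (1 : R).
  rewrite -[X in _ --> X](det1 R n).
  apply: (@entrywise_cvg_det R _ (nbhs (1%:M : 'M[R]_n)) _ n id) => i j.
  exact: coord_continuous.
have : \forall B \near (1%:M : 'M[R]_n), 1 - e < `|\det B|.
  have c1 : `|\det (B : 'M[R]_n)| @[B --> (1%:M : 'M[R]_n)] --> (1 : R).
    by rewrite -[X in _ --> X]normr1; apply: (cvg_norm c).
  by apply: (cvgr_gt _ c1); rewrite ltrBlDr ltrDl.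
move=> /nbhs_mxP [d d0 h]; exists d => // B hB; apply/ltW/h => i j.
by rewrite mxE.
Qed.

Section Norms.
Context {R : realType} {k J : nat} (N : 'M[R]_(k, J) -> R).
Hypothesis N_norm : is_norm N.

(** This domination is what makes the convergence independent of the norm. *)
Lemma norm_le_entries (A : 'M[R]_(k, J)) :
  N A <= \sum_i \sum_j `|A i j| * N (delta_mx i j).
Proof.
have [N0 _ NZ ND] := N_norm.
have N00 : N 0 = 0 by rewrite -(scale0r (0 : 'M[R]_(k, J))) NZ normr0 mul0r.
have Nsum I (r : seq I) (f : I -> 'M[R]_(k, J)) :
    N (\sum_(i <- r) f i) <= \sum_(i <- r) N (f i).
  elim: r => [|i r IHr]; first by rewrite !big_nil N00.
  by rewrite !big_cons; apply: (le_trans (ND _ _)); rewrite lerD2l.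
rewrite {1}[A]matrix_sum_delta; apply: (le_trans (Nsum _ _ _)).
apply: ler_sum => i _; apply: (le_trans (Nsum _ _ _)).
by apply: ler_sum => j _; rewrite NZ.
Qed.

Lemma cvg_norm_entrywise {U : Type} (F : set_system U) {FF : Filter F}
    (A : U -> 'M[R]_(k, J)) A0 :
  entrywise_cvg F A A0 -> N (A x - A0) @[x --> F] --> (0 : R).
Proof.
move=> cA; have [N0 _ _ _] := N_norm.
pose b x := \sum_i \sum_j `|(A x - A0) i j| * N (delta_mx i j).
have cb : b x @[x --> F] --> (0 : R).
  have -> : (0 : R) = \sum_(i < k) \sum_(j < J) `|A0 i j - A0 i j| * N (delta_mx i j).
    by rewrite big1 // => i _; rewrite big1 // => j _; rewrite subrr normr0 mul0r.
  apply: cvg_sumr => i _; apply: cvg_sumr => j _.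
  apply: cvgM; last exact: cvg_cst.
  apply: cvg_norm; under eq_cvg do rewrite !mxE.
  by apply: cvgB; [exact: cA|exact: cvg_cst].
apply: (squeeze_cvgr (f := cst 0) _ _ cb); last exact: cvg_cst.
by apply: nearW => x; rewrite N0 norm_le_entries.
Qed.

Lemma perm_distance_le (A B : 'M[R]_(k, J)) (s : 'S_k) :
  perm_distance N A B <= N (perm_mx s *m A - B).
Proof. by apply: bigmin_le_cond. Qed.

Lemma perm_distance_ge0 (A B : 'M[R]_(k, J)) : 0 <= perm_distance N A B.
Proof. have [N0 _ _ _] := N_norm; by apply: le_bigmin. Qed.

End Norms.
(** * The estimator in source coordinates *)

Section SourceWeights.
Context {R : realType} {J : nat}.

Lemma row_totalZ (a : R) (y : 'rV[R]_J) : row_total (a *: y) = a * row_total y.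
Proof. by rewrite /row_total mulr_sumr; apply: eq_bigr => j _; rewrite mxE. Qed.

Lemma row_total_normalize (y : 'rV[R]_J) :
  row_total y != 0 -> row_total (normalize_row y) = 1.
Proof. by move=> y0; rewrite /normalize_row row_totalZ mulVf. Qed.

Lemma row_total_mulmx {k} (x : 'rV[R]_k) (M : 'M[R]_(k, J)) :
  (forall i, \sum_j M i j = 1) -> row_total (x *m M) = row_total x.
Proof.
move=> M1; rewrite /row_total; under eq_bigr do rewrite mxE.
rewrite exchange_big; apply: eq_bigr => i _ /=.
by rewrite -mulr_sumr M1 mulr1.
Qed.

Lemma sample_mean_mulmx {k} n (x : nat -> 'rV[R]_k) (M : 'M[R]_(k, J)) :
  sample_mean n (fun i => x i *m M) = sample_mean n x *m M.
Proof. by rewrite /sample_mean -scalemxAl mulmx_suml. Qed.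

Lemma sample_mean_row_total n (y : nat -> 'rV[R]_J) :
  sample_mean (V := R^o) n (fun i => row_total (y i)) = row_total (sample_mean n y).
Proof.
rewrite /sample_mean row_totalZ; congr (_ * _).
rewrite /row_total exchange_big; apply: eq_bigr => j _ /=.
by rewrite summxE.
Qed.

Lemma sample_meanE n (y : nat -> 'rV[R]_J) j :
  sample_mean n y 0 j = n%:R^-1 * \sum_(i < n) y i 0 j.
Proof. by rewrite /sample_mean mxE summxE. Qed.

End SourceWeights.

(** The Gram matrix of a row-free matrix is invertible, so its Moore-Penrose
inverse is its inverse. *)
Lemma aug_right_inverseP {R : realType} {k J : nat} (M : 'M[R]_(k, J)) :
  row_free M -> augment M *m aug_right_inverse M = 1%:M.
Proof.
move=> /row_freeP[B MB].
have fA : row_free (augment M).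
  by apply/row_freeP; exists (col_mx B 0); rewrite mul_row_col mulmx0 addr0.
have uG := row_free_gram fA.
rewrite /aug_right_inverse mulmxA.
set G := augment M *m _ in uG *.
have [GGG _ _ _] := moore_penroseP G.
by rewrite -[G *m _](mulmxK uG) GGG mulmxV.
Qed.

Lemma perm_attribution {R : realType} {k J : nat} (s : 'S_k) (m : 'rV[R]_k) (H : 'M[R]_(k, J)) :
  perm_mx s *m attribution_matrix m H =
  attribution_matrix (m *m perm_mx s^-1%g) (perm_mx s *m H).
Proof.
rewrite -!row_permE -col_permE; apply/matrixP => i j; rewrite !mxE; congr (_ / _).
by rewrite (reindex_perm s); apply: eq_bigr => l _; rewrite !mxE.
Qed.

Section Estimator.
Context {R : realType} {K J : nat} (h : 'rV[R]_K.+1) (M : 'M[R]_(K.+1, J)).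
Hypothesis h_gt0 : forall k, 0 < h 0 k.
Hypothesis M_total : forall k, \sum_j M k j = 1.
Hypothesis M_free : row_free M.

Let H := diag_mx h *m M.
Implicit Type x : 'rV[R]_K.+1.

(** The barycentric coordinates, with respect to the rows of M, of the
normalized observation produced by the source vector x. *)
Definition source_weights (x : 'rV[R]_K.+1) : 'rV[R]_K.+1 :=
  normalize_row (x *m diag_mx h).

Lemma row_total_mixture x : row_total (x *m H) = row_total (x *m diag_mx h).
Proof. by rewrite mulmxA row_total_mulmx. Qed.

Lemma normalize_mixture x : normalize_row (x *m H) = source_weights x *m M.
Proof.
by rewrite /normalize_row row_total_mixture mulmxA scalemxAl.
Qed.

Lemma mul_diagE x k : (x *m diag_mx h) 0 k = x 0 k * h 0 k.
Proof. by rewrite mul_mx_diag mxE. Qed.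

Lemma source_weights_ge0 x k : (forall l, 0 <= x 0 l) -> 0 <= source_weights x 0 k.
Proof.
move=> x0; rewrite mxE mulr_ge0 //; last by rewrite mul_diagE mulr_ge0 // ltW.
by rewrite invr_ge0; apply: sumr_ge0 => l _; rewrite mul_diagE mulr_ge0 // ltW.
Qed.

(** At c e_k the weights are e_k, and they are continuous there because their
common denominator is c h_k > 0. *)
Lemma source_weights_near (c : R) k (delta : R) : 0 < c -> 0 < delta ->
  exists2 r : R, 0 < r & forall x, ball (c *: delta_mx 0 k : 'rV[R]_K.+1) r x ->
    forall l, `|source_weights x 0 l - (l == k)%:R| <= delta.
Proof.
move=> c0 delta0.
pose a : 'rV[R]_K.+1 := c *: delta_mx 0 k.
have Fa : Filter (nbhs a) by exact: nbhs_filter.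
have tot_a : row_total (a *m diag_mx h) = c * h 0 k.
  rewrite /row_total (bigD1 k) //= big1 ?addr0 => [|l lk]; rewrite mul_diagE !mxE eqxx.
    by rewrite eqxx mulr1.
  by rewrite (negPf lk) mulr0 mul0r.
have near_l l : \forall x \near a, `|source_weights x 0 l - (l == k)%:R| <= delta.
  have cl : source_weights x 0 l @[x --> a] --> ((l == k)%:R : R).
    have cd m : (x *m diag_mx h) 0 m @[x --> a] --> (a *m diag_mx h) 0 m.
      rewrite mul_diagE; under eq_cvg do rewrite mul_diagE.
      by apply: cvgM; [exact: coord_continuous|exact: cvg_cst].
    have -> : (l == k)%:R = (row_total (a *m diag_mx h))^-1 * (a *m diag_mx h) 0 l.
      rewrite tot_a mul_diagE !mxE eqxx /=; case: eqP => [->|_]; last by rewrite mulr0 mul0r mulr0.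
      by rewrite mulr1 mulVf // gt_eqF // mulr_gt0.
    under eq_cvg do rewrite mxE.
    apply: cvgM; last exact: cd.
    apply: cvgV; first by rewrite tot_a gt_eqF // mulr_gt0.
    by apply: cvg_sumr => m _; exact: cd.
  by apply: (cvgr_distC_le _ _ cl).
have near_all : \forall x \near a,
    forall l, `|source_weights x 0 l - (l == k)%:R| <= delta.
  exact: (@filter_forall _ _ _ (nbhs a) Fa near_l).
have [r /= r0 hr] := (nbhs_ballP _ _).1 near_all.
by exists r.
Qed.

(** The mixtures w M with w a probability vector form a convex set that contains
the normalized observations, hence their convex hull. *)
Lemma hull_coordinates (n : nat) (x : nat -> 'rV[R]_K.+1) (V : 'M[R]_(K.+1, J)) :
  (forall i k, 0 <= x i 0 k) ->
  (forall i, (i < n)%N -> 0 < row_total (x i *m H)) ->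
  (forall i, conv_hull [set normalize_row (x i *m H) | i in [set i | (i < n)%N]] (row i V)) ->
  exists2 L : 'M[R]_K.+1, row_stochastic L & V = L *m M.
Proof.
move=> x0 tot hV.
pose C := [set y : 'rV[R]_J | exists2 w : 'rV[R]_K.+1, row_stochastic w & y = w *m M].
have cC : convex_set (M := 'rV[R]_J) C.
  move=> y z t /set_mem [w [w0 w1] ->] /set_mem[v [v0 v1] ->]; apply/mem_set.
  exists (t%:num *: w + (1 - t%:num) *: v); last by rewrite mulmxDl -!scalemxAl.
  have t0 : 0 <= t%:num by [].
  have t1 : 0 <= 1 - t%:num by rewrite subr_ge0.
  split=> i; first by move=> k; rewrite !mxE addr_ge0 // mulr_ge0.
  under eq_bigr do rewrite !mxE.
  by rewrite big_split -!mulr_sumr /= w1 v1 !mulr1 addrC subrK.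
have hullC y : conv_hull [set normalize_row (x i *m H) | i in [set i | (i < n)%N]] y -> C y.
  apply: smallest_sub => // _ [i /= lt_in <-]; exists (source_weights (x i)).
    split=> j; first by move=> k; rewrite ord1; exact: source_weights_ge0.
    rewrite ord1; apply: row_total_normalize.
    by rewrite -row_total_mixture gt_eqF // tot.
  exact: normalize_mixture.
have /choice [w hw] : forall i, exists w : 'rV[R]_K.+1, row_stochastic w /\ row i V = w *m M.
  by move=> i; have [w ? ?] := hullC _ (hV i); exists w.
exists (\matrix_i w i).
  split=> i; first by move=> k; rewrite mxE; case: (hw i) => -[+ _] _; apply.
  under eq_bigr do rewrite mxE.
  by case: (hw i) => -[_ +] _; apply.
by apply/row_matrixP => i; rewrite row_mul rowK; case: (hw i).
Qed.

(** The augmented matrix of L M is L times that of M because L has row sums 1,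
and the augmented sample mean is (Wbar diag(h)) times that of M because M has
row sums 1; multiplying by the right inverse leaves Wbar diag(h) L^-1. *)
Lemma mean_estimatorE n (x : nat -> 'rV[R]_K.+1) (L : 'M[R]_K.+1) :
  L \in unitmx -> (forall i, \sum_k L i k = 1) ->
  mean_estimator n (fun i => x i *m H) (L *m M) *m L = sample_mean n x *m diag_mx h.
Proof.
move=> uL L1; rewrite /mean_estimator sample_mean_row_total sample_mean_mulmx.
rewrite row_total_mixture [_ *m H]mulmxA; set w := _ *m diag_mx h.
have augE : augment (L *m M) = L *m augment M.
  rewrite /augment mul_mx_row; congr row_mx; apply/matrixP => i j; rewrite !mxE.
  by rewrite -[LHS](L1 i); apply: eq_bigr => k _; rewrite mxE mulr1.
have -> : row_mx (w *m M) (const_mx (row_total w)) = w *m augment M.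
  rewrite /augment mul_mx_row; congr row_mx; apply/matrixP => i j; rewrite !mxE ord1.
  by apply: eq_bigr => k _; rewrite [const_mx _ _ _]mxE mulr1.
have free_LM : row_free (L *m M).
  have /row_freeP[B MB] := M_free.
  by apply/row_freeP; exists (B *m invmx L); rewrite mulmxA -(mulmxA L) MB mulmx1 mulmxV.
move: (aug_right_inverseP free_LM); move: (aug_right_inverse _) => B AB.
by rewrite -[augment M](mulKmx uL) -augE !mulmxA -(mulmxA _ (augment _)) AB mulmx1 mulmxKV.
Qed.

(** The deterministic core: if the sample mean of the sources is close to mu and
the observations approach every vertex, then the estimate is close to the
attribution matrix up to a permutation of rows. *)
Lemma attribution_stability (N : 'M[R]_(K.+1, J) -> R) (mu : 'rV[R]_K.+1) (e : R) :
  is_norm N -> 0 < e ->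
  (forall j, \sum_l mu 0 l * H l j != 0) ->
  exists delta1, exists2 delta2 : R, 0 < delta1 /\ 0 < delta2 & forall n (x : nat -> 'rV[R]_K.+1) V,
    (forall i k, 0 <= x i 0 k) ->
    (forall i, (i < n)%N -> 0 < row_total (x i *m H)) ->
    max_volume_points
      (conv_hull [set normalize_row (x i *m H) | i in [set i | (i < n)%N]]) V ->
    (forall k, `|sample_mean n x 0 k - mu 0 k| <= delta1) ->
    (forall k, exists2 i, (i < n)%N &
       forall l, `|source_weights (x i) 0 l - (l == k)%:R| <= delta2) ->
    perm_distance N
      (attribution_matrix (mean_estimator n (fun i => x i *m H) V) V)
      (attribution_matrix mu H) <= e.
Proof.
move=> N_norm e0 den.
pose G (p : 'rV[R]_K.+1 * 'M[R]_K.+1) :=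
  attribution_matrix (p.1 *m diag_mx h *m invmx p.2) (p.2 *m M).
pose p0 : 'rV[R]_K.+1 * 'M[R]_K.+1 := (mu, 1%:M).
have G0 : G p0 = attribution_matrix mu H.
  have HE k j : H k j = h 0 k * M k j by rewrite /H mul_diag_mx mxE.
  rewrite /G /= invmx1 mulmx1 mul1mx; apply/matrixP => k j.
  rewrite ![attribution_matrix _ _ _ _]mxE.
  rewrite mul_diagE HE mulrA; congr (_ / _).
  by apply: eq_bigr => l _; rewrite mul_diagE HE mulrA.
have cG : N (G p - G p0) @[p --> p0] --> (0 : R).
  have c1 : entrywise_cvg (nbhs p0) (fun p => p.1) mu.
    move=> i j; apply: (@cvg_comp _ _ _ fst (fun w : 'rV[R]_K.+1 => w i j) _ (nbhs mu)).
      exact: cvg_fst.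
    exact: coord_continuous.
  have c2 : entrywise_cvg (nbhs p0) (fun p => p.2) 1%:M.
    move=> i j.
    apply: (@cvg_comp _ _ _ snd (fun L : 'M[R]_K.+1 => L i j) _ (nbhs (1%:M : 'M[R]_K.+1))).
      exact: cvg_snd.
    exact: coord_continuous.
  have cc m n (A : 'M[R]_(m, n)) : entrywise_cvg (nbhs p0) (fun=> A) A.
    by move=> i j; exact: cvg_cst.
  apply: cvg_norm_entrywise => //; apply: entrywise_cvg_attribution.
  - move=> j; rewrite /= invmx1 mulmx1 mul1mx.
    under eq_bigr do rewrite mul_diagE -mulrA; move: (den j); congr (_ != _).
    apply: eq_bigr => l _.
    by rewrite /H mul_diag_mx mxE.
  - apply: entrywise_cvgM; first exact: entrywise_cvgM.
    by apply: entrywise_cvg_invmx => //; exact: unitmx1.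
  - exact: entrywise_cvgM.
have : \forall p \near p0, N (G p - G p0) < e by exact: (cvgr_lt _ cG).
case=> -[A B] /= [/nbhs_mxP[d1 d1_gt0 hA] /nbhs_mxP[eta eta0 hB]] hAB.
have [eps eps0 near_perm] := @near_permutation R K.+1 _ eta0.
(* The bound 1/2 is only there to keep det L away from 0. *)
pose eps' := Num.min eps 2^-1.
have eps'0 : 0 < eps' by rewrite lt_min eps0 invr_gt0 ltr0n.
have [d2 d2_gt0 hdet] := @near_det1 R K.+1 _ eps'0.
exists d1, d2 => // n x V x0 tot [hV maxV] hmean hvert.
have [L sL VE] := hull_coordinates x0 tot hV.
have [L0 L1] := sL.
have /choice [I0 hI0] : forall k, exists i, (i < n)%N /\
    forall l, `|source_weights (x i) 0 l - (l == k)%:R| <= d2.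
  by move=> k; have [i ? ?] := hvert k; exists i.
pose L2 : 'M[R]_K.+1 := \matrix_k source_weights (x (I0 k)).
have L2_1 k : \sum_l L2 k l = 1.
  under eq_bigr do rewrite mxE.
  apply: row_total_normalize; rewrite -row_total_mixture gt_eqF // tot //.
  by case: (hI0 k).
(* The simplex of the near-vertices competes in the maximization, and dividing
   both volumes by that of M compares the determinants. *)
have le_det : 1 - eps' <= `|\det L|.
  apply: (@le_trans _ _ `|\det L2|).
    by apply: hdet => k l; rewrite mxE eq_sym; case: (hI0 k) => _; apply.
  rewrite -(ler_pM2r (simplex_volume_gt0 M_free)).
  rewrite -(simplex_volumeM _ L2_1) -(simplex_volumeM _ L1) -VE.
  apply: maxV => k; rewrite row_mul rowK -normalize_mixture.
  by apply: sub_gen_smallest; exists (I0 k) => //; case: (hI0 k).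
have uL : L \in unitmx.
  rewrite unitmxE unitfE -normr_gt0; apply: lt_le_trans le_det.
  have : eps' <= 2^-1 by rewrite ge_min lexx orbT.
  by lra.
have [|s hs] := near_perm L sL.
  by apply: le_trans le_det; rewrite lerD2l lerN2 ge_min lexx.
(* Row i of L' is the row of L that is close to the i-th unit vector. *)
pose t := (s^-1)%g; pose L' := perm_mx t *m L.
have hL' : B L'.
  apply: hB => i k; rewrite /L' -row_permE !mxE.
  by have := hs (t i) k; rewrite permKV eq_sym.
have uL' : L' \in unitmx by rewrite unitmx_mul unitmx_perm.
have hA' : A (sample_mean n x) by apply: hA => i k; rewrite ord1.
apply: (le_trans (perm_distance_le _ _ _ t)).
rewrite perm_attribution VE -G0 mulmxA -/L'.
set m := mean_estimator _ _ _.
have -> : m *m perm_mx t^-1%g = sample_mean n x *m diag_mx h *m invmx L'.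
  rewrite -(mean_estimatorE n x uL L1) -[LHS](mulmxK uL').
  by congr (_ *m _); rewrite /L' mulmxA -(mulmxA m) -perm_mxM mulVg perm_mx1 mulmx1.
by apply/ltW; exact: (hAB (sample_mean n x, L')).
Qed.

End Estimator.
(** * Stationary ergodic processes *)

Section StationaryProcess.
Context {R : realType} {K : nat} {d : measure_display} {T : measurableType d}.
Variables (P : probability T R) (W : nat -> T -> 'rV[R]_K).
Hypothesis W_process : random_process W.
Hypothesis W_stationary : stationary P W.
Hypothesis W_ergodic : ergodic P W.

Let path := g_sigma_algebraType (@cylinders R K).

Lemma measurable_sample_path : measurable_fun [set: T] (sample_path W : T -> path).
Proof.
apply: (@measurability _ _ T path _ (sample_path W) (@cylinders R K) erefl)
  => _ [_ [i [k [B [mB ->]]]] <-].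
exact: W_process.
Qed.

Lemma measurable_path_shift : measurable_fun [set: path] (path_shift : path -> path).
Proof.
apply: (@measurability _ _ path path _ path_shift (@cylinders R K) erefl)
  => _ [_ [i [k [B [mB ->]]]] <-].
by rewrite setTI; apply: sub_gen_smallest; exists i.+1, k, B.
Qed.

Lemma measurable_coordinate i k : measurable_fun [set: path] (fun x : path => x i 0 k).
Proof.
move=> _ B mB; rewrite setTI.
by apply: sub_gen_smallest; exists i, k, B.
Qed.

Lemma measurable_path_ball (a : 'rV[R]_K) (r : R) : 0 < r ->
  measurable [set x : path | ball a r (x 0%N)].
Proof.
move=> r0.
have -> : [set x : path | ball a r (x 0%N)] =
    \big[setI/setT]_(k < K) [set x : path | ball (a 0 k) r (x 0%N 0 k)].
  apply/seteqP; split=> x /=.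
    case=> _ hx; by elim/big_ind: _ => // k _; exact: hx.
  move=> hx; split=> // i k; rewrite ord1.
  by move: hx; rewrite (bigD1 k) //= => -[].
apply: bigsetI_measurable => k _.
have := measurable_coordinate 0 k measurableT (measurable_ball (a 0 k) r).
by rewrite setTI.
Qed.

Lemma measurable_process_ball (a : 'rV[R]_K) (r : R) : 0 < r ->
  measurable [set w | ball a r (W 0%N w)].
Proof.
move=> /(measurable_path_ball a) mB.
by have := measurable_sample_path measurableT mB; rewrite setTI.
Qed.

Lemma iter_path_shift i (x : path) : iter i path_shift x 0%N = x i.
Proof.
suff E j : iter i path_shift x j = x (i + j)%N by rewrite E addn0.
by elim: i j => [|i IHi] j //=; rewrite {1}/path_shift IHi addSnnS.
Qed.

Let path_mfun : {mfun T >-> path} :=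
  MeasurableFun.Pack (MeasurableFun.Class
    (isMeasurableFun.Build _ _ _ _ _ measurable_sample_path)).

(** The shift on the path space, with the law of the process, is measure
preserving and ergodic, and the Birkhoff sums of x |-> g (x 0) along a sample
path are the sums of the g (W i). *)
Lemma process_upper_bound (g : 'rV[R]_K -> R) (a : R) :
  measurable_fun [set: path] (fun x : path => g (x 0%N)) ->
  P.-integrable [set: T] (fun w => (g (W 0%N w))%:E) ->
  (\int[P]_w (g (W 0%N w))%:E < a%:E)%E ->
  (forall n, measurable [set w | n%:R * a < \sum_(i < n) g (W i w)]) /\
  P [set w | n%:R * a < \sum_(i < n) g (W i w)] @[n --> \oo] --> 0%E.
Proof.
move=> mg intg ltga.
pose f (x : path) := g (x 0%N).
pose Q := distribution P path_mfun.
have mf : measurable_fun [set: path] (EFin \o f) by exact/measurable_EFinP.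
have intf : Q.-integrable [set: path] (EFin \o f).
  exact: (integrable_pushforward measurable_sample_path).
have ltfa : (\int[Q]_x (f x)%:E < a%:E)%E.
  by rewrite (integral_pushforward measurable_sample_path (f := EFin \o f)).
have pres (A : set path) : measurable A -> Q (path_shift @^-1` A) = Q A by exact: W_stationary.
have erg (A : set path) : measurable A -> path_shift @^-1` A = A -> Q A = 0%E \/ Q A = 1%E.
  exact: W_ergodic.
have msum n : measurable_fun [set: T] (fun w => \sum_(i < n) g (W i w)).
  apply: measurable_sum => i.
  have -> : (fun w => g (W i w)) = f \o (iter i path_shift \o sample_path W).
    by apply/funext => w; rewrite /f /= iter_path_shift.
  apply: measurableT_comp; first exact/measurable_EFinP.
  apply: measurableT_comp measurable_sample_path.
  elim: (i : nat) => [|j IHj]; first exact: measurable_id.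
  exact: (measurableT_comp measurable_path_shift IHj).
split=> [n|].
  have := msum n measurableT `]n%:R * a, +oo[%classic (measurable_itv _).
  rewrite setTI; congr (measurable _).
  by apply/seteqP; split=> w /=; rewrite in_itv /= andbT.
have := ergodic_upper_bound measurable_path_shift pres erg intf ltfa.
apply: cvg_trans; apply: near_eq_cvg; apply: nearW => n /=.
rewrite /Q /distribution /pushforward; congr (P _); apply/seteqP.
have E w : \sum_(i < n) f (iter i path_shift (sample_path W w)) = \sum_(i < n) g (W i w).
  by apply: eq_bigr => i _; rewrite /f iter_path_shift.
by split=> w /=; rewrite E.
Qed.

End StationaryProcess.

Section Vanishing.
Context {R : realType} {d : measure_display} {T : measurableType d}.
Variable P : probability T R.

Definition vanishing (A : nat -> set T) : Prop :=
  (forall n, measurable (A n)) /\ P (A n) @[n --> \oo] --> 0%E.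

Lemma vanishingU A B : vanishing A -> vanishing B -> vanishing (fun n => A n `|` B n).
Proof.
move=> [mA PA] [mB PB]; split; first by move=> n; exact: measurableU.
have h : (P (A n) + P (B n))%E @[n --> \oo] --> 0%E.
  by rewrite -(adde0 (0%E : \bar R)); apply: (cvgeD _ PA PB).
apply: (squeeze_cvge (f := cst 0%E) _ _ h); last exact: cvg_cst.
apply: nearW => n; rewrite measure_ge0 /=.
exact: measureU2.
Qed.

Lemma vanishing_bigU {I : Type} (r : seq I) (A : I -> nat -> set T) :
  (forall i, vanishing (A i)) -> vanishing (fun n => \big[setU/set0]_(i <- r) A i n).
Proof.
move=> vA; elim: r => [|i r IHr].
  split=> [n|]; first by rewrite big_nil.
  have -> : (fun n => P (\big[setU/set0]_(i <- [::]) A i n)) = cst 0%E.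
    by apply/funext => n; rewrite big_nil measure0.
  exact: cvg_cst.
have -> : (fun n => \big[setU/set0]_(j <- i :: r) A j n) =
    (fun n => A i n `|` \big[setU/set0]_(j <- r) A j n).
  by apply/funext => n; rewrite big_cons.
exact: vanishingU.
Qed.

Lemma null_vanishing Z : measurable Z -> P Z = 0%E -> vanishing (fun=> Z).
Proof. by move=> mZ PZ; split=> //; rewrite PZ; exact: cvg_cst. Qed.

(** Measurable exceptional events suffice, although the events in the
conclusion need not be measurable. *)
Lemma cvg_in_probability0_vanishing (X : nat -> T -> R) :
  (forall e, 0 < e -> exists2 A, vanishing A &
     \forall n \near \oo, forall w, ~ A n w -> `|X n w| <= e) ->
  cvg_in_probability0 P X.
Proof.
move=> h e e0; have [A [mA PA] near_A] := h e e0.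
apply: (squeeze_cvge (f := cst 0%E) _ _ PA); last exact: cvg_cst.
apply: filterS near_A => n hn; rewrite mu_ext_ge0 /=; last by move=> ?; exact: measure_ge0.
rewrite -(measurable_mu_extE P (mA n)); apply: le_mu_ext => w /= ltw.
by apply: contrapT => /hn; rewrite leNgt ltw.
Qed.

End Vanishing.

(** * Consistency *)

Section Consistency.
Context {R : realType} {d : measure_display} {T : measurableType d}.
Context {P : probability T R} {K : nat} {W : nat -> T -> 'rV[R]_K.+1}.
Hypothesis W_process : random_process W.
Hypothesis W_stationary : stationary P W.
Hypothesis W_ergodic : ergodic P W.
Hypothesis W_mean : forall k,
  P.-integrable [set: T] (EFin \o (fun w => W 0%N w 0 k)).

Let mu := mean_vector P (W 0%N).

Lemma mean_vectorE k : (\int[P]_w (W 0%N w 0 k)%:E = (mu 0 k)%:E)%E.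
Proof.
rewrite /mu mxE fineK ?unlock //; exact: (integrable_fin_num measurableT (W_mean k)).
Qed.

Lemma sample_mean_vanishing (delta : R) k : 0 < delta ->
  exists2 A, vanishing P A & forall n w, (0 < n)%N -> ~ A n w ->
    `|sample_mean n (fun i => W i w) 0 k - mu 0 k| <= delta.
Proof.
move=> delta0.
have [mU PU] : vanishing P
    (fun n => [set w | n%:R * (mu 0 k + delta) < \sum_(i < n) W i w 0 k]).
  apply: (process_upper_bound W_process W_stationary W_ergodic (g := fun x => x 0 k)).
  - exact: measurable_coordinate.
  - exact: W_mean.
  - by rewrite mean_vectorE lte_fin ltrDl.
have [mL PL] : vanishing P
    (fun n => [set w | n%:R * (- mu 0 k + delta) < \sum_(i < n) - W i w 0 k]).
  apply: (process_upper_bound W_process W_stationary W_ergodic (g := fun x => - x 0 k)).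
  - by apply: measurableT_comp => //; exact: measurable_coordinate.
  - exact: (integrableN (W_mean k)).
  - under eq_integral do rewrite EFinN.
    rewrite integralN; last by exact: integrable_add_def (W_mean k).
    by rewrite mean_vectorE -EFinN lte_fin ltrDl.
exists (fun n => [set w | n%:R * (mu 0 k + delta) < \sum_(i < n) W i w 0 k]
    `|` [set w | n%:R * (- mu 0 k + delta) < \sum_(i < n) - W i w 0 k]).
  by apply: vanishingU; split.
move=> n w n0 /not_orP [/negP + /negP]; rewrite -!leNgt sumrN => hU hL.
have n0' : 0 < n%:R :> R by rewrite ltr0n.
rewrite sample_meanE ler_norml lerBrDr lerBlDr ler_pdivlMl // ler_pdivrMl //.
by apply/andP; split; lra.
Qed.

(** Without a visit the empirical frequency of the ball is 0, while it exceeds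
half of the positive probability p of the ball with probability tending
to 1. *)
Lemma visit_vanishing (a : 'rV[R]_K.+1) (r : R) : 0 < r ->
  law_support P (W 0%N) a ->
  exists2 A, vanishing P A & forall n w, (0 < n)%N -> ~ A n w ->
    exists2 i, (i < n)%N & ball a r (W i w).
Proof.
move=> r0 /(_ r r0) P_gt0.
pose B : set 'rV[R]_K.+1 := ball a r.
pose path := g_sigma_algebraType (@cylinders R K.+1).
have mB : measurable [set x : path | B (x 0%N)] by exact: measurable_path_ball.
have mBW : measurable [set w | B (W 0%N w)] by exact: measurable_process_ball.
have finP : P [set w | B (W 0%N w)] \is a fin_num by exact: fin_num_measure.
pose p := fine (P [set w | B (W 0%N w)]).
have PE : P [set w | B (W 0%N w)] = p%:E by rewrite fineK.
have p0 : 0 < p by rewrite -lte_fin -PE.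
have int1 : P.-integrable [set: T] (fun w => (\1_[set w | B (W 0%N w)] w)%:E).
  exact: integrable_indic.
have [mV PV] : vanishing P
    (fun n => [set w | n%:R * (- (p / 2)) < \sum_(i < n) - \1_B (W i w)]).
  apply: (process_upper_bound W_process W_stationary W_ergodic (g := fun x => - \1_B x)).
  - apply: measurableT_comp => //.
    exact: (measurable_indic mB).
  - exact: (integrableN int1).
  - under eq_integral do rewrite EFinN.
    rewrite integralN; last by exact: integrable_add_def int1.
    have -> : (\int[P]_w (\1_B (W 0%N w))%:E = p%:E)%E.
      by rewrite -PE -[in RHS](setIT [set w | B (W 0%N w)]) -integral_indic.
    by rewrite -EFinN lte_fin; lra.
eexists; first by split; [exact: mV|exact: PV].
move=> n w n0 /negP; rewrite -leNgt sumrN => hV.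
apply: contrapT => no_visit.
move: hV; rewrite big1 => [|i _].
  rewrite oppr0 leNgt pmulr_rlt0 ?ltr0n // oppr_lt0 divr_gt0 //.
by rewrite indicE memNset // => hB; apply: no_visit; exists i.
Qed.

(** Markov's inequality at level c / 2, a level which is exceeded on the ball of
radius c / 2 around c e_k. *)
Lemma mean_vector_gt0 k (c : R) : (forall w, 0 <= W 0%N w 0 k) -> 0 < c ->
  law_support P (W 0%N) (c *: delta_mx 0 k) -> 0 < mu 0 k.
Proof.
move=> W0 c0 supp.
rewrite -lte_fin -mean_vectorE.
have c2 : 0 < c / 2 by rewrite divr_gt0.
have mW : measurable_fun [set: T] (fun w => (W 0%N w 0 k)%:E).
  by case/integrableP: (W_mean k).
have := le_integral_abse P measurableT mW c2.
have -> : (\int[P]_w `|(W 0%N w 0 k)%:E| = \int[P]_w (W 0%N w 0 k)%:E)%E.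
  by apply: eq_integral => w _; rewrite gee0_abs ?lee_fin.
apply: lt_le_trans; apply: mule_gt0 => //; rewrite setTI.
apply: lt_le_trans (supp (c / 2) c2) _.
apply: le_measure; rewrite ?inE.
- exact: measurable_process_ball.
- rewrite -[X in measurable X]setTI.
  by apply: emeasurable_fun_c_infty => //; exact: measurableT_comp.
- move=> w [_ /(_ 0 k)]; rewrite /ball /= !mxE !eqxx mulr1 => hw.
  rewrite lee_fin ger0_norm // ltW //.
  have := le_lt_trans (ler_norm _) hw; lra.
Qed.

End Consistency.

Theorem mainTheorem7 (R : realType) (d : measure_display)
    (T : measurableType d) (P : probability T R) (K J : nat)
    (H : 'M[R]_(K.+1, J))
    (W : nat -> T -> 'rV[R]_K.+1) (Y : nat -> T -> 'rV[R]_J)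
    (Hstar : nat -> T -> 'M[R]_(K.+1, J))
    (N : 'M[R]_(K.+1, J) -> R)
    (H_ge0 : forall k j, 0 <= H k j)
    (H_full_row_rank : row_free H)
    (H_col_neq0 : forall j, col j H != 0)
    (W_process : random_process W)
    (W_ge0 : forall i w k, 0 <= W i w 0 k)
    (W_stationary : stationary P W)
    (W_ergodic : ergodic P W)
    (W_mean : forall k,
       P.-integrable [set: T] (EFin \o (fun w => W 0%N w 0 k)))
    (W_separable : exists c : 'I_K.+1 -> R, forall k,
       0 < c k /\ law_support P (W 0%N) (c k *: delta_mx 0 k))
    (Y_def : forall i w, Y i w = W i w *m H)
    (Y_total_gt0 : {ae P, forall w, forall i, 0 < row_total (Y i w)})
    (Hstar_max : forall n w, (0 < n)%N ->
       max_volume_points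
         (conv_hull [set normalize_row (Y i w) | i in [set i | (i < n)%N]])
         (Hstar n w))
    (N_norm : is_norm N) :
  cvg_in_probability0 P (fun n w =>
    perm_distance N
      (attribution_matrix
         (mean_estimator n (fun i => Y i w) (Hstar n w)) (Hstar n w))
      (attribution_matrix (mean_vector P (W 0%N)) H)).
Proof.
have {Y_def} YE : Y = fun i w => W i w *m H.
  by apply/funext => i; apply/funext => w; exact: Y_def.
subst Y.
pose h : 'rV[R]_K.+1 := \row_k row_total (row k H).
pose M : 'M[R]_(K.+1, J) := \matrix_k normalize_row (row k H).
have h_gt0 k : 0 < h 0 k.
  rewrite mxE /row_total lt_neqAle; apply/andP; split; last first.
    by apply: sumr_ge0 => j _; rewrite mxE.
  apply/eqP => /esym/eqP; rewrite psumr_eq0; last by move=> j _; rewrite mxE.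
  move=> /allP row0.
  have row_eq : (delta_mx 0 k : 'rV[R]_K.+1) *m H = 0 *m H.
    rewrite -rowE mul0mx; apply/rowP => j.
    by have /eqP -> := row0 j (mem_index_enum j); rewrite mxE.
  have /rowP/(_ k)/eqP := row_free_inj H_full_row_rank row_eq.
  by rewrite !mxE !eqxx oner_eq0.
have HE : H = diag_mx h *m M.
  apply/matrixP => k j; rewrite mul_diag_mx !mxE mulrA divff ?mul1r //.
  by have := h_gt0 k; rewrite mxE => /gt_eqF ->.
have M_total k : \sum_j M k j = 1.
  under eq_bigr do rewrite mxE; apply: row_total_normalize.
  by have := h_gt0 k; rewrite mxE => /gt_eqF ->.
have M_free : row_free M.
  have /row_freeP[B HB] := H_full_row_rank.
  apply/row_freeP; exists (B *m diag_mx h).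
  by rewrite mulmxA; apply: mulmx1C; rewrite mulmxA -HE.
have [c hc] := W_separable.
have mu_gt0 k : 0 < mean_vector P (W 0%N) 0 k.
  have [ck supp] := hc k.
  by apply: (mean_vector_gt0 W_process W_mean _ ck supp) => w; exact: W_ge0.
have den j : \sum_l mean_vector P (W 0%N) 0 l * (diag_mx h *m M) l j != 0.
  rewrite -HE psumr_eq0 => [|l _]; last by rewrite mulr_ge0 // ltW.
  move: (H_col_neq0 j); apply: contra => /allP all0.
  apply/eqP/colP => l; have := all0 l (mem_index_enum l).
  by rewrite mulf_eq0 gt_eqF //= => /eqP Hlj; rewrite !mxE.
rewrite HE in Y_total_gt0 Hstar_max *.
apply: cvg_in_probability0_vanishing => e e0.
have [d1 [d2 [d1_gt0 d2_gt0] stable]] :=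
  attribution_stability h_gt0 M_total M_free N_norm e0 den.
have [Z [mZ PZ hZ]] := Y_total_gt0.
have /choice[A hA] : forall k, exists A, vanishing P A /\
    forall n w, (0 < n)%N -> ~ A n w ->
      `|sample_mean n (fun i => W i w) 0 k - mean_vector P (W 0%N) 0 k| <= d1.
  move=> k.
  have [A ? ?] := sample_mean_vanishing W_process W_stationary W_ergodic W_mean k d1_gt0.
  by exists A.
have /choice[B hB] : forall k, exists B, vanishing P B /\
    forall n w, (0 < n)%N -> ~ B n w -> exists2 i, (i < n)%N &
      forall l, `|source_weights h (W i w) 0 l - (l == k)%:R| <= d2.
  move=> k; have [ck supp] := hc k.
  have [r r0 hr] := source_weights_near h_gt0 k ck d2_gt0.
  have [B vB hB] := visit_vanishing W_process W_stationary W_ergodic r0 supp.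
  exists B; split=> // n w n0 Bnw; have [i lt_in /hr hi] := hB n w n0 Bnw.
  by exists i.
exists (fun n => Z `|` \big[setU/set0]_(k < K.+1) (A k n `|` B k n)).
  apply: vanishingU; first exact: null_vanishing.
  apply: vanishing_bigU => k.
  by apply: vanishingU; [case: (hA k)|case: (hB k)].
exists 1%N => // n /= n0 w /not_orP[Zw badw].
have goodw k : ~ A k n w /\ ~ B k n w.
  by apply/not_orP; apply: contra_not badw; rewrite (bigD1 k) //=; left.
have tot i : 0 < row_total (W i w *m (diag_mx h *m M)).
  by move: i; apply: contrapT; apply: contra_not Zw; exact: hZ.
rewrite ger0_norm ?perm_distance_ge0 //.
apply: (stable n (fun i => W i w)) => //.
- exact: Hstar_max.
- by move=> k; case: (hA k) => _; apply=> //; case: (goodw k).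
- by move=> k; case: (hB k) => _; apply=> //; case: (goodw k).
Qed.
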